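(* Let $G$ be a trivalent graph with a perfect matching $M$, and let $\Gamma_M$ be a perfect matching graph for the pair $(G,M)$, represented by a ribbon diagram in the plane whose virtual crossings involve only edges of $G\setminus M$. Then for every positive integer $n$, $\left\llbracket \Gamma_M\right\rrbracket=\{G,M\}$.
   Context: Graphs are finite multigraphs. A ribbon graph of $G$ is an embedding of $G$ into a compact surface with boundary that deformation retracts onto the image of $G$; a perfect matching graph $\Gamma_M$ is a ribbon graph of $G$ with a perfect matching $M=\{e_1,\dots,e_\ell\}$. A ribbon diagram is a drawing of it in the plane respecting the cyclic order of edges at each vertex; edge crossings in the drawing are virtual crossings; let $X$ be the set of virtual crossings. Smoothings: for a matching edge $e=uv$ with other edge-ends $a,b$ at $u$ and $c,d$ at $v$, $a$ and $c$ on the same side of $e$, the $0$-smoothing deletes $e,u,v$ and joins $a$–$c$ and $b$–$d$ by two parallel arcs; the $1$-smoothing joins $a$–$d$ and $b$–$c$ by two arcs crossing once (an ordinary crossing). For $\alpha\in\{0,1\}^\ell$ the state $\Gamma_\alpha$ is the resulting collection of closed immersed curves, $|\alpha|=\sum\alpha_i$; each matching edge gives a pair of arcs of $\Gamma_\alpha$. Penrose–Kauffman bracket: $$\left\llbracket \Gamma_M\right\rrbracket=\sum_{\alpha\in\{0,1\}^\ell}\ \sum_{\beta:X\to\{\mathrm{node},\mathrm{cross}\}}(-1)^{|\alpha|}\,2^{\#\beta^{-1}(\mathrm{node})}\,(-1)^{\#\beta^{-1}(\mathrm{cross})}\,n^{c(\alpha,\beta)},$$ where $c(\alpha,\beta)$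 is the number of connected components of the space obtained from the disjoint union of the curves of $\Gamma_\alpha$ by gluing together the two strands at each virtual crossing $x$ with $\beta(x)=\mathrm{node}$ (strands at ''cross'' crossings just pass through). Equivalently it is defined recursively by: matching edge $=$ $0$-smoothing $-$ $1$-smoothing; virtual crossing $=2\cdot$(node, the two strands treated as part of one circle) $-$ (ordinary crossing); each closed curve, with curves joined at nodes counting as one, has value $n$. Color bracket: $\{G,M\}=\sum_{\alpha}N(\Gamma_\alpha)$, where $N(\Gamma_\alpha)$ is the number of assignments of colors from $\{1,\dots,n\}$ to the curves of $\Gamma_\alpha$ such that, for each matching edge, the two arcs produced by smoothing it lie on curves of different colors. This equals the number of perfect matching $n$-colorings of $(G,M)$: colorings of the non-matching edges with colors from $\{1,\dots,n\}$ such that exactly two distinct colors are used on the edges adjacent to each matching edge and both colors appear at each end of the matching edge. *)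

(* Defs.v *)
(* Combinatorial-map encoding of a planar ribbon diagram of a
   trivalent graph with a perfect matching, virtual crossings being 4-valent
   vertices of the map. *)
From mathcomp Require Import all_boot all_order all_algebra.
Set Implicit Arguments. Unset Strict Implicit. Unset Printing Implicit Defensive.
Import GRing.Theory Num.Theory.
Local Open Scope ring_scope.

Section RibbonDiagram.
Variables (D : finType) (al sg : D -> D) (mt : D -> bool).
(* D  : darts (half-edges) of the planar drawing, where each virtual crossing
        is an extra 4-valent vertex subdividing the (non-matching) edges;
   al : the edge involution (the other end of the edge segment);
   sg : the rotation (cyclic order of darts around a vertex, in the plane);
   mt : dart belongs to a matching edge. *)

Definition is_map : Prop :=
  (forall d, al (al d) = d) /\ (forall d, al d != d) /\ injective sg.

Definition map_vertices : nat := fcard sg D.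
Definition map_edges : nat := (#|D| %/ 2)%N.
Definition map_faces : nat := fcard (sg \o al) D.
Definition map_conn (x y : D) : bool := (y == sg x) || (x == sg y) || (y == al x).
Definition map_components : nat := n_comp map_conn D.

(* genus 0 on every component: the map is a drawing in the plane *)
Definition planar_map : Prop :=
  (map_vertices + map_faces = map_edges + 2 * map_components)%N.

(* walking along a strand straight through a crossing *)
Definition strand_step (d : D) : D := sg (sg (al d)).

(* vertices of G are the 3-valent vertices, virtual crossings the 4-valent ones;
   exactly one matching dart at each vertex of G; no matching dart at a
   crossing; every strand through crossings ends at vertices of G. *)
Definition trivalent_pm_diagram : Prop :=
  [/\ is_map, planar_map,
      (forall d, order sg d = 3%N \/ order sg d = 4%N),
      (forall d, mt (al d) = mt d) &
      [/\ (forall d, order sg d = 3%N -> (mt d + mt (sg d) + mt (sg (sg d)) = 1)%N),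
          (forall d, order sg d = 4%N -> mt d = false) &
          (forall d, exists k, order sg (al (iter k strand_step d)) = 3%N)]].

Definition matching_edges : {set D} := [set d | mt d && froots al d].
Definition crossings : {set D} := [set d | (order sg d == 4%N) && froots sg d].

(* a state alpha is the set of matching edges receiving the 1-smoothing *)
(* smoothing pairs at the matching edge of dart m: with a = sg m, b = sg^2 m,
   c = sg (al m), d = sg^2 (al m), the pairs on the same side of the edge are
   (a,d) and (b,c); 0-smoothing joins a-d, b-c; 1-smoothing joins a-c, b-d *)
Definition smooth_rel (alpha : {set D}) (m x y : D) : bool :=
  mt m &&
  (if froot al m \in alpha then
     ((x == sg m) && (y == sg (al m))) || ((x == sg (sg m)) && (y == sg (sg (al m))))
   else
     ((x == sg m) && (y == sg (sg (al m)))) || ((x == sg (sg m)) && (y == sg (al m)))).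

(* beta = set of crossings resolved as "node" (the two strands glued) *)
Definition state_rel0 (alpha beta : {set D}) (x y : D) : bool :=
  ~~ mt x && ~~ mt y &&
  [|| y == al x,
      (order sg x == 4%N) && (y == sg (sg x)),
      (order sg x == 4%N) && (froot sg x \in beta) && (y == sg x)
    | [exists m, smooth_rel alpha m x y]].

Definition state_rel (alpha beta : {set D}) (x y : D) : bool :=
  state_rel0 alpha beta x y || state_rel0 alpha beta y x.

Definition ncomp_state (alpha beta : {set D}) : nat :=
  n_comp (state_rel alpha beta) [pred d | ~~ mt d].

Definition pk_bracket (n : nat) : int :=
  \sum_(alpha in powerset matching_edges) \sum_(beta in powerset crossings)
    ((-1) ^+ #|alpha| * (2%:Z) ^+ #|beta| * (-1) ^+ (#|crossings| - #|beta|)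
       * (n%:Z) ^+ ncomp_state alpha beta).

(* N(Gamma_alpha): colourings of the curves of Gamma_alpha (functions on darts
   constant along curves; a matching dart copies the colour of its successor
   so that it carries no extra freedom) such that the two arcs of each
   matching edge lie on curves of different colours *)
Definition state_colorings (n : nat) (alpha : {set D}) : nat :=
  #|[set col : {ffun D -> 'I_n} |
      [forall x, forall y, state_rel alpha set0 x y ==> (col x == col y)] &&
      [forall m, mt m ==> (col m == col (sg m)) && (col (sg m) != col (sg (sg m)))]]|.

Definition color_bracket (n : nat) : int :=
  \sum_(alpha in powerset matching_edges) (state_colorings n alpha)%:Z.

End RibbonDiagram.

(* Main.v *)
(** Both brackets count the colourings of the strands in which the two ends of
    every matching edge carry the same two distinct colours.

    Expand [n ^ c] as the number of colourings constant on the components, and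
    sum over the states first.  A crossing then contributes [2 - 1 = 1] if its
    two strands have the same colour and [-1] otherwise; a matching edge
    contributes [0] unless its ends carry the same two distinct colours, in which
    case exactly one smoothing fits, with sign [1] if it is parallel and [-1] if
    it is crossed.  It remains to see that the crossings between strands of
    different colours, virtual or created by a 1-smoothing, are even in number.

    For a colour [t], the edges of colour below [t] (a matching edge counted with
    both its colours) form a mod 2 cycle.  As the map has genus 0, a dimension
    count shows that it is the boundary of a set of faces, with indicator [f t].
    The sum of [f (col x) x] over the non-matching darts [x] vanishes when
    computed edge by edge, and is the number of bichromatic crossings mod 2 when
    computed vertex by vertex. *)
Require Import Defs.
From mathcomp Require Import all_boot all_algebra.
From mathcomp Require Import mxabelem zify ring.

Set Implicit Arguments.
Unset Strict Implicit.
Unset Printing Implicit Defensive.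

Import GRing.Theory.

Section EdgeConst.
Variable T : finType.
Implicit Types (e : rel T) (a : {pred T}).

Definition edge_const (R : eqType) e (f : T -> R) : bool :=
  [forall x, forall y, e x y ==> (f x == f y)].

Lemma edge_constP (R : eqType) e (f : T -> R) :
  reflect (forall x y, e x y -> f x = f y) (edge_const e f).
Proof.
apply: (iffP forallP) => [fe x y exy|fe x].
  by apply/eqP; move/forallP/(_ y): (fe x); rewrite exy.
by apply/forallP=> y; apply/implyP=> /fe ->.
Qed.

Lemma edge_const_connect (R : eqType) e (f : T -> R) x y :
  edge_const e f -> connect e x y -> f x = f y.
Proof.
move=> /edge_constP fe /connectP[p + ->].
by elim: p x => //= z p IH x /andP[/fe -> /IH].
Qed.

Lemma edge_const_symmetrize (R : eqType) e (f : T -> R) :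
  edge_const [rel x y | e x y || e y x] f = edge_const e f.
Proof.
apply/edge_constP/edge_constP => fe x y => [exy|/orP[]/fe //].
by apply: fe; rewrite /= exy.
Qed.

Lemma card_edge_const_retract (R : finType) e a (k : T -> T) :
    connect_sym e -> closed e a ->
    (forall x, k x \in a) -> {in a, forall x, k x = x} ->
    (forall x y, e x y -> connect e (k x) (k y)) ->
  #|[set f : {ffun T -> R} | edge_const e f && [forall x, f x == f (k x)]]|
    = #|R| ^ n_comp e a.
Proof.
move=> symE clA ka k_id ke; pose r x := fingraph.root e (k x).
pose S := {x : T | roots e x && (x \in a)}.
have rS x : roots e (r x) && (r x \in a).
  by rewrite roots_root // -(closed_connect clA (connect_root e (k x))) ka.
have -> : n_comp e a = #|{: S}| by rewrite card_sig; apply: eq_card.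
pose extend (g : {ffun S -> R}) : {ffun T -> R} := [ffun x => g (exist _ (r x) (rS x))].
have extendE g x y : r x = r y -> extend g x = extend g y.
  by move=> rxy; rewrite !ffunE; congr (g _); apply: val_inj.
have extend_inj : injective extend.
  move=> g1 g2 /ffunP eq_g; apply/ffunP=> s; have /andP[/eqP s_root s_a] := svalP s.
  have := eq_g (sval s); rewrite !ffunE.
  suff -> : exist _ (r (sval s)) (rS (sval s)) = s by [].
  by apply: val_inj; rewrite /= /r k_id.
rewrite -card_ffun -(card_imset predT extend_inj); apply: eq_card => f; rewrite inE.
apply/andP/imsetP => [[fe /forallP fk]|[g _ ->]].
  exists [ffun s : S => f (sval s)] => //; apply/ffunP=> x; rewrite !ffunE /=.
  by rewrite (eqP (fk x)) (edge_const_connect fe (connect_root e (k x))).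
split; last by apply/forallP=> x; rewrite (extendE g x (k x)) // /r [k (k x)]k_id.
by apply/edge_constP=> x y /ke kxy; apply: extendE; apply/fingraph.rootP.
Qed.

End EdgeConst.

Section Orbits.
Variables (T : finType) (p : T -> T).
Hypothesis injp : injective p.

Lemma froot_invariant (R : eqType) (k : T -> R) x :
  (forall y, k (p y) = k y) -> k (froot p x) = k x.
Proof.
move=> kp; apply/esym/(fconnect_invariant _ (connect_root _ x)) => y /=.
by rewrite kp eqxx.
Qed.

Lemma froot_step x : froot p (p x) = froot p x.
Proof.
by apply/esym/fingraph.rootP; [apply: fconnect_sym | apply: fconnect1].
Qed.

Lemma big_froots (R : Type) (idx : R) (op : Monoid.com_law idx) (P : pred T) (G : T -> R) :
    (forall x, P (p x) = P x) ->
  \big[op/idx]_(x | P x) G x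
    = \big[op/idx]_(x | P x && froots p x) \big[op/idx]_(y <- orbit p x) G y.
Proof.
move=> Pp; have symp := fconnect_sym injp.
rewrite (partition_big (froot p) (fun x => P x && froots p x)) /=; last first.
  by move=> x Px; rewrite roots_root // froot_invariant // Px.
apply: eq_bigr => x /andP[Px /eqP x_root]; rewrite big_uniq ?orbit_uniq //.
apply: eq_bigl => y; rewrite -fconnect_orbit symp -(root_connect symp) x_root.
by apply: andb_idl => /eqP yx; rewrite -(froot_invariant y Pp) yx.
Qed.

Lemma forall_froots (P Q : pred T) :
    (forall x, P (p x) = P x) -> (forall x, P x -> Q (p x) = Q x) ->
  [forall x in [set x | P x && froots p x], Q x] = [forall x, P x ==> Q x].
Proof.
move=> Pp Qp; apply/forall_inP/forallP => [allQ x|allQ x]; last first.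
  by rewrite inE => /andP[Px _]; apply: implyP (allQ x) Px.
apply/implyP=> Px.
have PQp y : P (p y) && Q (p y) = P y && Q y.
  by rewrite Pp; case: (boolP (P y)) => // /Qp ->.
have : P (froot p x) && Q (froot p x).
  rewrite allQ ?inE ?roots_root ?(froot_invariant x Pp) ?Px //.
  exact: fconnect_sym.
by rewrite (froot_invariant x PQp) => /andP[].
Qed.

End Orbits.

Lemma order_involution (T : finType) (p : T -> T) x :
  involutive p -> p x != x -> order p x = 2.
Proof.
move=> pK px; have cyc : fcycle p [:: x; p x] by rewrite /= pK !eqxx.
by rewrite (order_cycle cyc) ?inE ?eqxx //= inE eq_sym px.
Qed.

Section OrthogonalSpace.
Variables (F : fieldType) (n : nat).
Local Open Scope ring_scope.

Definition ortho_mx m (U : 'M[F]_(m, n)) := kermx U^T.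

Lemma sub_ortho_mxC m1 m2 (U : 'M[F]_(m1, n)) (V : 'M_(m2, n)) :
  (U <= ortho_mx V)%MS = (V <= ortho_mx U)%MS.
Proof. by rewrite !sub_kermx -trmx_eq0 trmx_mul trmxK. Qed.

Lemma sub_ortho_addsmx m1 m2 m3 (U : 'M[F]_(m1, n)) (V : 'M_(m2, n))
    (W : 'M_(m3, n)) :
  (U <= ortho_mx (V + W)%MS)%MS = (U <= ortho_mx V)%MS && (U <= ortho_mx W)%MS.
Proof. by rewrite sub_ortho_mxC addsmx_sub !(sub_ortho_mxC U). Qed.

Lemma mxrank_ortho m (U : 'M[F]_(m, n)) : \rank (ortho_mx U) = (n - \rank U)%N.
Proof. by rewrite mxrank_ker mxrank_tr. Qed.

End OrthogonalSpace.

Section FunctionSpace.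
Variables (F : fieldType) (T : finType).
Local Open Scope ring_scope.
Implicit Types (v w : 'rV[F]_#|T|) (f : T -> F) (p : T -> T).

Definition row_fun v (x : T) : F := v 0 (enum_rank x).
Definition fun_row f : 'rV[F]_#|T| := \row_i f (enum_val i).

Lemma fun_rowK f : row_fun (fun_row f) =1 f.
Proof. by move=> x; rewrite /row_fun mxE enum_rankK. Qed.

Lemma row_funP v w : row_fun v =1 row_fun w <-> v = w.
Proof.
split=> [eq_vw|-> //]; apply/rowP=> i.
by have := eq_vw (enum_val i); rewrite /row_fun enum_valK.
Qed.

Definition shift_mx p : 'M[F]_#|T| :=
  colsub (fun i => enum_rank (p (enum_val i))) 1%:M - 1%:M.

Lemma row_fun_mul_shift p v x :
  row_fun (v *m shift_mx p) x = row_fun v (p x) - row_fun v x.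
Proof. by rewrite /row_fun mulmxBr mulmx_colsub mulmx1 !mxE enum_rankK. Qed.

Definition inv_mx p := kermx (shift_mx p).

Lemma inv_mxP p v :
  reflect (forall x, row_fun v (p x) = row_fun v x) (v <= inv_mx p)%MS.
Proof.
apply: (iffP sub_kermxP) => [v0 x|vp].
  by apply/eqP; rewrite -subr_eq0 -row_fun_mul_shift v0 /row_fun mxE.
by apply/row_funP=> x; rewrite row_fun_mul_shift vp subrr /row_fun mxE.
Qed.

Lemma inv_mxI p q v :
  (v <= inv_mx p :&: inv_mx q)%MS = edge_const (relU (frel p) (frel q)) (row_fun v).
Proof.
rewrite sub_capmx; apply/andP/edge_constP => [[/inv_mxP vp /inv_mxP vq] x y|vpq].
  by case/orP=> /eqP <-; rewrite ?vp ?vq.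
by split; apply/inv_mxP=> x; apply/esym/vpq; rewrite /= eqxx ?orbT.
Qed.

Lemma sub_ortho_mxP m v (U : 'M[F]_(m, #|T|)) :
  reflect (forall w, (w <= U)%MS -> \sum_x row_fun v x * row_fun w x = 0)
          (v <= ortho_mx U)%MS.
Proof.
have dotE w : (v *m w^T) 0 0 = \sum_x row_fun v x * row_fun w x.
  rewrite mxE (reindex (@enum_rank T)) /=; last first.
    by exists enum_val => x _; rewrite ?enum_rankK ?enum_valK.
  by apply: eq_bigr => x _; rewrite mxE.
apply: (iffP idP) => [vU w wU|vU].
  rewrite -dotE; have : (v <= ortho_mx w)%MS.
    by rewrite sub_ortho_mxC (submx_trans wU) // sub_ortho_mxC.
  by move/sub_kermxP=> ->; rewrite mxE.
rewrite sub_ortho_mxC; apply/row_subP=> i; rewrite sub_ortho_mxC.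
by apply/sub_kermxP/rowP=> j; rewrite ord1 dotE vU ?row_sub // mxE.
Qed.

Lemma shift_mx_ortho_inv p : injective p -> (shift_mx p <= ortho_mx (inv_mx p))%MS.
Proof.
move=> injp; apply/row_subP=> i; apply/sub_ortho_mxP=> w /inv_mxP wp.
rewrite rowE; move: (delta_mx _ _) => v.
under eq_bigr do rewrite row_fun_mul_shift mulrBl -{1}wp.
by rewrite sumrB [X in _ - X](reindex_inj injp) subrr.
Qed.

Lemma orbit_sum0_ortho_inv p v : injective p ->
    (forall x, \sum_(y <- orbit p x) row_fun v y = 0) ->
  (v <= ortho_mx (inv_mx p))%MS.
Proof.
move=> injp v_orb; apply/sub_ortho_mxP=> w /inv_mxP wp.
rewrite (@big_froots _ p) // big1 // => x _.
transitivity ((\sum_(y <- orbit p x) row_fun v y) * row_fun w x).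
  rewrite mulr_suml; apply: eq_big_seq => y; rewrite -fconnect_orbit => xy.
  congr (_ * _); apply/esym; apply: (fconnect_invariant (f := p) _ xy) => z.
  by rewrite /= wp eqxx.
by rewrite v_orb mul0r.
Qed.

End FunctionSpace.

Section InvariantRank.
Variables (F : finFieldType) (T : finType).

Lemma mxrank_edge_const (e : rel T) m (U : 'M[F]_(m, #|T|)) :
    connect_sym e -> (forall v : 'rV_#|T|, (v <= U)%MS = edge_const e (row_fun v)) ->
  \rank U = n_comp e T.
Proof.
move=> symE UE; apply: (@expnI #|F|); first exact: card_finNzRing_gt1.
rewrite -card_rowg -(@card_edge_const_retract T F e T id symE) // => [|x y]; last first.
  exact: connect1.
pose to_ffun v : {ffun T -> F} := [ffun x => row_fun v x].
have to_ffun_inj : injective to_ffun.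
  by move=> v w /ffunP eq_vw; apply/row_funP=> x; have := eq_vw x; rewrite !ffunE.
rewrite -(card_imset _ to_ffun_inj); apply: eq_card => f; rewrite inE.
apply/imsetP/andP => [[v + ->]|[fe _]].
  rewrite mem_rowg UE => /edge_constP ve; split; last by apply/forallP=> x.
  by apply/edge_constP=> x y /ve; rewrite !ffunE.
exists (fun_row f); last by apply/ffunP=> x; rewrite ffunE fun_rowK.
rewrite mem_rowg UE; apply/edge_constP=> x y; rewrite !fun_rowK.
exact: (edge_constP _ _ fe).
Qed.

Lemma mxrank_inv_mx p : injective p -> \rank (inv_mx F p) = fcard p T.
Proof.
move=> injp; apply: mxrank_edge_const => [|v]; first exact: fconnect_sym.
apply/inv_mxP/edge_constP => [vp x y /eqP <-|vp x] //.
by apply/esym/vp/eqP.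
Qed.

End InvariantRank.

Section PlanarMap.
Variables (D : finType) (al sg : D -> D).
Hypotheses (mapD : is_map al sg) (planD : planar_map al sg).
Local Open Scope ring_scope.

Let alK : involutive al. Proof. by case: mapD. Qed.
Let injsg : injective sg. Proof. by case: mapD => _ []. Qed.
Let injal : injective al. Proof. exact: inv_inj alK. Qed.
Let injface : injective (sg \o al). Proof. exact: inj_comp. Qed.

Lemma order_edge d : order al d = 2%N.
Proof. by apply: order_involution => //; case: mapD => _ []. Qed.

Lemma card_darts : #|D| = (fcard al D * 2)%N.
Proof. by rewrite fcard_order_set //; apply/subsetP=> d _; rewrite inE order_edge. Qed.

Lemma map_edgesE : map_edges D = fcard al D.
Proof. by rewrite /map_edges card_darts mulnK. Qed.

Lemma map_conn_sym : connect_sym (map_conn al sg).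
Proof.
apply: sym_connect_sym => x y; rewrite /map_conn (orbC (y == sg x)).
by congr (_ || _); apply/eqP/eqP => ->; rewrite alK.
Qed.

Variable F : finFieldType.
Local Notation edge_inv := (inv_mx F al).
Local Notation vertex_inv := (inv_mx F sg).
Local Notation face_inv := (inv_mx F (sg \o al)).

Definition face_boundary_mx : 'M[F]_#|D| := face_inv *m shift_mx F al.
Definition cycle_mx : 'M[F]_#|D| := ortho_mx (edge_inv + vertex_inv)%MS.

Lemma mxrank_edge_vertex_cap : \rank (edge_inv :&: vertex_inv)%MS = map_components al sg.
Proof.
apply: mxrank_edge_const map_conn_sym _ => v; rewrite inv_mxI.
apply/edge_constP/edge_constP => vc x y.
  case/orP=> [/orP[]|] /eqP ->; last by apply: vc; rewrite /= eqxx.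
    by apply: vc; rewrite /= eqxx orbT.
  by apply/esym/vc; rewrite /= eqxx orbT.
by case/orP=> /eqP <-; apply: vc; rewrite /map_conn eqxx ?orbT.
Qed.

Lemma face_edge_cap : (face_inv :&: edge_inv == edge_inv :&: vertex_inv)%MS.
Proof.
apply/rV_eqP=> v; rewrite capmxC !sub_capmx; apply: andb_id2l => /inv_mxP vA.
apply/inv_mxP/inv_mxP => v_inv d; last by rewrite /= v_inv vA.
by have := v_inv (al d); rewrite /= alK vA.
Qed.

Lemma mxrank_face_boundary_mx :
  (\rank face_boundary_mx + map_components al sg = map_faces al sg)%N.
Proof.
rewrite -mxrank_edge_vertex_cap -(eqmx_rank face_edge_cap) mxrank_mul_ker.
exact: mxrank_inv_mx.
Qed.

Lemma mxrank_cycle_mx :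
  (\rank cycle_mx + map_vertices sg = map_edges D + map_components al sg)%N.
Proof.
have rankE : \rank edge_inv = fcard al D := mxrank_inv_mx F injal.
have rankV : \rank vertex_inv = fcard sg D := mxrank_inv_mx F injsg.
have := mxrank_sum_cap edge_inv vertex_inv; rewrite mxrank_edge_vertex_cap rankE rankV.
rewrite mxrank_ortho map_edgesE; have := rank_leq_col (edge_inv + vertex_inv)%MS.
by move: (\rank _) card_darts; rewrite /map_vertices; lia.
Qed.

Lemma face_boundary_sub_cycle : (face_boundary_mx <= cycle_mx)%MS.
Proof.
have face_inv_shift : face_boundary_mx = face_inv *m shift_mx F sg.
  apply/row_matrixP=> i; rewrite /face_boundary_mx !(row_mul i face_inv).
  have := row_sub i face_inv; move: (row i face_inv) => v /inv_mxP v_face.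
  apply/row_funP=> d; rewrite !row_fun_mul_shift.
  by rewrite -(v_face (al d)) /= alK.
rewrite sub_ortho_addsmx; apply/andP; split; last rewrite face_inv_shift.
  exact: submx_trans (submxMl _ _) (shift_mx_ortho_inv F injal).
exact: submx_trans (submxMl _ _) (shift_mx_ortho_inv F injsg).
Qed.

Lemma face_boundary_eq_cycle : (face_boundary_mx == cycle_mx)%MS.
Proof.
rewrite -(mxrank_leqif_eq face_boundary_sub_cycle); apply/eqP.
move: planD mxrank_face_boundary_mx mxrank_cycle_mx; rewrite /planar_map.
by move: (\rank _) (\rank _); lia.
Qed.

Lemma boundary_of_cycle (s : D -> F) :
    (forall d, s (al d) = - s d) -> (forall d, \sum_(y <- orbit sg d) s y = 0) ->
  exists2 f : D -> F, forall d, f (sg d) = f d + s d & forall d, f (al d) = f d + s d.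
Proof.
move=> s_al s_sg; have : (fun_row s <= cycle_mx)%MS.
  rewrite sub_ortho_addsmx; apply/andP; split; apply: orbit_sum0_ortho_inv => // d;
    under eq_bigr do rewrite fun_rowK; last exact: s_sg.
  by rewrite /orbit order_edge !big_cons big_nil /= s_al addr0 subrr.
rewrite -(eqmxP face_boundary_eq_cycle) => /submxP[u]; rewrite mulmxA => su.
have /inv_mxP w_face : (u *m face_inv <= face_inv)%MS by exact: submxMl.
have w_al d : row_fun (u *m face_inv) (al d) = row_fun (u *m face_inv) d + s d.
  by rewrite -(fun_rowK s) su row_fun_mul_shift addrC subrK.
exists (row_fun (u *m face_inv)) => // d.
by rewrite -w_al -(w_face (al d)) /= alK.
Qed.

End PlanarMap.

Lemma natr_card_set (R : pzSemiRingType) (T : finType) (b : pred T) :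
  (#|[set x | b x]|%:R = \sum_x (b x)%:R :> R)%R.
Proof.
rewrite -sum1_card natr_sum big_mkcond /=.
by apply: eq_bigr => x _; rewrite inE; case: (b x).
Qed.

Section PowersetSum.
Variables (R : comPzSemiRingType) (T : finType).
Implicit Types (X B : {set T}) (b c : pred T).
Local Open Scope ring_scope.

Lemma natr_forall_in X b : [forall x in X, b x]%:R = \prod_(x in X) (b x)%:R :> R.
Proof.
rewrite -big_andE (big_morph (fun b' : bool => b'%:R : R) (id1 := 1) (op1 := *%R)) //.
by move=> [] []; rewrite ?mulr1 ?mulr0.
Qed.

Lemma prodr_powerset_const X B (x y : R) : B \subset X ->
  \prod_(t in X) (if t \in B then x else y) = x ^+ #|B| * y ^+ (#|X| - #|B|).
Proof.
move=> sBX; rewrite (big_setID B) /= (setIidPr sBX) -cardsDS // -!prodr_const.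
congr (_ * _); first by apply: eq_bigr => t ->.
by apply: eq_bigr => t; rewrite inE => /andP[/negPf ->].
Qed.

Lemma sum_powerset_prod X (F G : T -> R) :
  \sum_(B in powerset X) \prod_(t in X) (if t \in B then F t else G t)
    = \prod_(t in X) (F t + G t).
Proof.
pose F' t := if t \in X then F t else 0; pose G' t := if t \in X then G t else 1.
transitivity (\prod_t (F' t + G' t)); last first.
  rewrite [RHS]big_mkcond; apply: eq_bigr => t _; rewrite /F' /G'.
  by case: ifP; rewrite ?add0r.
rewrite bigA_distr [LHS]big_mkcond; apply: eq_bigr => B _; rewrite powersetE.
case: ifPn => [sBX|/subsetPn[t tB tX]]; last first.
  by rewrite (bigD1 t) //= tB /F' (negPf tX) mul0r.
rewrite [LHS]big_mkcond; apply: eq_bigr => t _; rewrite /F' /G'.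
by case: ifPn => // tX; rewrite (contraNF (subsetP sBX t) tX).
Qed.

Lemma sum_powerset_forall X (x y : R) b c :
  \sum_(B in powerset X) x ^+ #|B| * y ^+ (#|X| - #|B|)
      * [forall t in X, if t \in B then b t else c t]%:R
    = \prod_(t in X) (x * (b t)%:R + y * (c t)%:R).
Proof.
rewrite -sum_powerset_prod; apply: eq_bigr => B; rewrite powersetE => sBX.
rewrite -prodr_powerset_const // natr_forall_in -big_split.
by apply: eq_bigr => t _ /=; case: ifP.
Qed.

End PowersetSum.

Section Diagram.
Variables (D : finType) (al sg : D -> D) (mt : D -> bool).
Hypothesis diag : trivalent_pm_diagram al sg mt.

Let mapD : is_map al sg. Proof. by case: diag. Qed.
Let alK : involutive al. Proof. by case: mapD. Qed.
Let injsg : injective sg. Proof. by case: mapD => _ []. Qed.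
Let injal : injective al. Proof. exact: inv_inj alK. Qed.
Let mt_al d : mt (al d) = mt d. Proof. by case: diag. Qed.

Lemma order_sg d : order sg (sg d) = order sg d.
Proof. exact: order_id_cycle (cycle_orbit injsg d). Qed.

Lemma order_noncrossing d : order sg d != 4 -> order sg d = 3.
Proof. by case: diag => _ _ ord _ _; case: (ord d) => // ->. Qed.

Lemma sg3_noncrossing d : order sg d != 4 -> sg (sg (sg d)) = d.
Proof. by move=> /order_noncrossing o; have := iter_order injsg d; rewrite o. Qed.

Lemma mt_crossing d : order sg d = 4 -> mt d = false.
Proof. by case: diag => _ _ _ _ [_ + _]; apply. Qed.

Lemma mt_noncrossing m : mt m -> order sg m != 4.
Proof. by apply: contraL => /eqP/mt_crossing ->. Qed.

Lemma mt_vertex d : mt d + mt (sg d) + mt (sg (sg d)) = (order sg d != 4).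
Proof.
have [o|/order_noncrossing o] := eqVneq (order sg d) 4.
  by rewrite !mt_crossing ?order_sg.
by case: diag => _ _ _ _ [+ _ _]; apply.
Qed.

Lemma mt_sg m : mt m -> mt (sg m) = false /\ mt (sg (sg m)) = false.
Proof.
by move=> mm; have := mt_vertex m; rewrite mm mt_noncrossing //; do 2!case: (mt (sg _)).
Qed.

Lemma big_nonmatching (R : Type) (idx : R) (op : Monoid.com_law idx) (G : D -> R) :
  \big[op/idx]_(x | ~~ mt x) G x =
  op (\big[op/idx]_(m | mt m) op (G (sg m)) (G (sg (sg m))))
     (\big[op/idx]_(x | order sg x == 4) G x).
Proof.
have mt_sg3 d : mt (sg (sg (sg d))) = mt d.
  have [o|/sg3_noncrossing -> //] := eqVneq (order sg d) 4.
  by rewrite !mt_crossing ?order_sg.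
rewrite (bigID (fun x => order sg x == 4)) /= Monoid.mulmC; congr (op _ _); last first.
  by apply: eq_bigl => x; apply: andb_idl => /eqP/mt_crossing ->.
rewrite big_split (bigID (fun x => mt (sg x))) /= Monoid.mulmC; congr (op _ _).
  rewrite (reindex_inj injsg); apply: eq_bigl => x; rewrite order_sg.
  by have := mt_vertex x; do 3!case: (mt _); case: (_ == _).
rewrite (reindex_inj injsg) (reindex_inj injsg); apply: eq_bigl => x.
rewrite mt_sg3 !order_sg.
by have := mt_vertex x; do 3!case: (mt _); case: (_ == _).
Qed.

Lemma big_crossings (R : Type) (idx : R) (op : Monoid.com_law idx) (G : D -> R) :
  \big[op/idx]_(x | order sg x == 4) G x =
  \big[op/idx]_(x in crossings sg)
     op (G x) (op (G (sg x)) (op (G (sg (sg x))) (G (sg (sg (sg x)))))).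
Proof.
rewrite (big_froots injsg) => [|x]; last by rewrite order_sg.
apply: eq_big => [x|x /andP[/eqP o _]]; first by rewrite inE.
by rewrite /orbit o !big_cons big_nil Monoid.mulm1.
Qed.

Lemma big_matching_edges (R : Type) (idx : R) (op : Monoid.com_law idx) (G : D -> R) :
  \big[op/idx]_(m | mt m) G m =
  \big[op/idx]_(m in matching_edges al mt) op (G m) (G (al m)).
Proof.
rewrite (big_froots injal) //; apply: eq_big => [m|m _]; first by rewrite inE.
by rewrite /orbit (order_edge mapD) !big_cons big_nil Monoid.mulm1.
Qed.

Lemma forall_matching_edges (Q : pred D) : (forall m, mt m -> Q (al m) = Q m) ->
  [forall m in matching_edges al mt, Q m] = [forall m, mt m ==> Q m].
Proof. exact: forall_froots. Qed.

Lemma forall_crossings (Q : pred D) : (forall x, order sg x = 4 -> Q (sg x) = Q x) ->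
  [forall x in crossings sg, Q x] = [forall x, (order sg x == 4) ==> Q x].
Proof.
move=> Qsg; apply: (@forall_froots _ _ injsg (fun x => order sg x == 4)) => x.
  by rewrite order_sg.
by move/eqP/Qsg.
Qed.

Section Coloring.
Variables (C : eqType) (col : D -> C).

Definition strand_const : bool :=
  [forall x, (~~ mt x ==> (col (al x) == col x)) &&
             ((order sg x == 4) ==> (col (sg (sg x)) == col x))].

Lemma strand_constP :
  reflect ((forall x, ~~ mt x -> col (al x) = col x) /\
           (forall x, order sg x = 4 -> col (sg (sg x)) = col x))
          strand_const.
Proof.
apply: (iffP forallP) => [sc|[col_al col_sg2] x].
  split=> x; case/andP: (sc x) => /implyP col_al /implyP col_sg2.
    by move/col_al/eqP.
  by move/eqP/col_sg2/eqP.
apply/andP; split; apply/implyP; first by move/col_al=> ->.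
by move/eqP/col_sg2=> ->.
Qed.

Definition parallel_match m : bool :=
  (col (sg m) == col (sg (sg (al m)))) && (col (sg (sg m)) == col (sg (al m))).

Definition crossed_match m : bool :=
  (col (sg m) == col (sg (al m))) && (col (sg (sg m)) == col (sg (sg (al m)))).

Definition bichromatic_end m : bool := col (sg m) != col (sg (sg m)).

Definition two_colored m : bool :=
  bichromatic_end m && (parallel_match m || crossed_match m).

Lemma parallel_match_al m : parallel_match (al m) = parallel_match m.
Proof. by rewrite /parallel_match alK andbC; congr (_ && _); rewrite eq_sym. Qed.

Lemma crossed_match_al m : crossed_match (al m) = crossed_match m.
Proof. by rewrite /crossed_match alK; congr (_ && _); rewrite eq_sym. Qed.

Lemma bichromatic_end_al m :
  parallel_match m || crossed_match m -> bichromatic_end (al m) = bichromatic_end m.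
Proof. by rewrite /bichromatic_end => /orP[]/andP[/eqP -> /eqP ->]; rewrite // eq_sym. Qed.

Lemma two_colored_al m : two_colored (al m) = two_colored m.
Proof.
rewrite /two_colored parallel_match_al crossed_match_al.
by case: (boolP (_ || _)) => [/bichromatic_end_al -> //|]; rewrite !andbF.
Qed.

Lemma parallel_matchE m : parallel_match m = crossed_match m (+) two_colored m.
Proof.
rewrite /two_colored /bichromatic_end /parallel_match /crossed_match.
have [eq_end|neq_end] := eqVneq (col (sg m)) (col (sg (sg m))).
  by rewrite eq_end addbF andbC.
apply/idP/idP; last by case: (_ && _) (_ && _) => [] [].
move=> /andP[/eqP <- /eqP <-]; rewrite !eqxx (negPf neq_end).
by rewrite eq_sym (negPf neq_end).
Qed.

Definition pm_coloring : bool :=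
  strand_const && [forall m in matching_edges al mt, two_colored m].

End Coloring.

Section ColorPotential.
Variables (n : nat) (col : D -> 'I_n).
Hypothesis col_pm : pm_coloring col.

Let col_al x : ~~ mt x -> col (al x) = col x.
Proof. by move: x; have /andP[/strand_constP[]] := col_pm. Qed.

Let col_sg2 x : order sg x = 4 -> col (sg (sg x)) = col x.
Proof. by move: x; have /andP[/strand_constP[]] := col_pm. Qed.

Let col_two_colored m : mt m -> two_colored col m.
Proof.
have /andP[_] := col_pm; rewrite forall_matching_edges => [/forallP/(_ m)/implyP //|x _].
exact: two_colored_al.
Qed.

(* The cycle of edges of colour below [t]; a matching edge carries both colours
   of its ends, which cancel mod 2 when both are below [t]. *)
Definition color_below (t : nat) d : bool :=
  if mt d then (col (sg d) < t) (+) (col (sg (sg d)) < t) else col d < t.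

Lemma color_below_al t d : color_below t (al d) = color_below t d.
Proof.
rewrite /color_below mt_al; case: ifPn => [/col_two_colored/andP[_]|/col_al -> //].
by case/orP=> /andP[/eqP -> /eqP ->]; rewrite // addbC.
Qed.

Lemma sum_color_below_vertex t d :
  \big[addb/false]_(y <- orbit sg d) color_below t y = false.
Proof.
have := mt_vertex d; have [o _|o] := eqVneq (order sg d) 4.
  rewrite /orbit o !big_cons big_nil /= /color_below !mt_crossing ?order_sg //.
  by rewrite !col_sg2 ?order_sg //; do 2!case: (_ < t).
rewrite /orbit (order_noncrossing o) !big_cons big_nil /= /color_below.
rewrite !sg3_noncrossing ?order_sg //.
by do 3!case: (mt _) => //; do 3!case: (_ < t).
Qed.

Lemma color_below_potential : exists2 f : 'I_n -> D -> bool,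
  forall t d, f t (sg d) = f t d (+) color_below t d &
  forall t d, f t (al d) = f t d (+) color_below t d.
Proof.
apply: (@fin_all_exists2 _ (fun=> D -> bool)
  (fun (t : 'I_n) g => forall d, g (sg d) = g d (+) color_below t d)
  (fun (t : 'I_n) g => forall d, g (al d) = g d (+) color_below t d)) => t.
have planD : planar_map al sg by case: diag.
(* In the field [bool], [- b] is [b] and [b + c] is [b (+) c]. *)
exact: (boundary_of_cycle mapD planD (color_below_al t) (sum_color_below_vertex t)).
Qed.

Variable f : 'I_n -> D -> bool.
Hypothesis f_sg : forall t d, f t (sg d) = f t d (+) color_below t d.
Hypothesis f_al : forall t d, f t (al d) = f t d (+) color_below t d.

Definition own_potential x : bool := f (col x) x.

Lemma sum_own_potential : \big[addb/false]_(x | ~~ mt x) own_potential x = false.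
Proof.
rewrite (big_froots injal) => [|x]; last by rewrite mt_al.
rewrite big1 // => x /andP[mx _]; rewrite /orbit (order_edge mapD) !big_cons big_nil /=.
by rewrite /own_potential col_al // f_al /color_below (negPf mx) ltnn !addbF addbb.
Qed.

Lemma own_potential_crossing x : order sg x = 4 ->
  own_potential x (+) (own_potential (sg x) (+)
    (own_potential (sg (sg x)) (+) own_potential (sg (sg (sg x)))))
  = (col x != col (sg x)).
Proof.
move=> ox; rewrite /own_potential !f_sg /color_below !mt_crossing ?order_sg //.
rewrite !col_sg2 ?order_sg // !ltnn -val_eqE /=.
by case: ltngtP; case: (f _ _); case: (f _ _).
Qed.

Lemma own_potential_matching_edge m : mt m ->
  own_potential (sg m) (+) own_potential (sg (sg m)) (+)
    (own_potential (sg (al m)) (+) own_potential (sg (sg (al m))))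
  = crossed_match col m.
Proof.
move=> mm; have [mt_sgm _] := mt_sg mm; have [mt_sgam _] := mt_sg (etrans (mt_al m) mm).
have := col_two_colored mm.
rewrite /own_potential !f_sg !f_al !color_below_al /color_below mm mt_sgm mt_sgam.
rewrite /two_colored /bichromatic_end /parallel_match /crossed_match.
move: (col (sg m)) (col (sg (sg m))) (col (sg (al m))) (col (sg (sg (al m)))) => a b c d.
rewrite -!val_eqE /= => /andP[ab].
by case/orP=> /andP[/eqP/val_inj <- /eqP/val_inj <-]; move: ab; rewrite ?eqxx ?ltnn /=;
  case: (f a m); case: (f b m); case: ltngtP.
Qed.

End ColorPotential.

Lemma bichromatic_crossings_even n (col : D -> 'I_n) : pm_coloring col ->
  \big[addb/false]_(m in matching_edges al mt) crossed_match col m (+)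
    \big[addb/false]_(x in crossings sg) (col x != col (sg x)) = false.
Proof.
move=> col_pm; have [f f_sg f_al] := color_below_potential col_pm.
rewrite -[RHS](sum_own_potential col_pm f_al).
rewrite big_nonmatching big_crossings big_matching_edges /=.
congr (_ (+) _); apply: eq_bigr => x; rewrite inE => /andP[].
  by move=> mx _; rewrite -(own_potential_matching_edge col_pm f_sg f_al mx).
by move=> /eqP ox _; rewrite -(own_potential_crossing col_pm f_sg ox).
Qed.

Section States.
Variable C : eqType.
Implicit Types (alpha beta : {set D}) (col : D -> C).

Definition node_const beta col : bool :=
  [forall x in crossings sg, (x \in beta) ==> (col x == col (sg x))].

Definition smoothing_const alpha col : bool :=
  [forall m in matching_edges al mt,
     if m \in alpha then crossed_match col m else parallel_match col m].

Lemma node_const_froot beta col : strand_const col ->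
  node_const beta col
    = [forall x, (order sg x == 4) ==> (froot sg x \in beta) ==> (col x == col (sg x))].
Proof.
case/strand_constP=> _ col_sg2.
rewrite -(forall_crossings (Q := fun x => (froot sg x \in beta) ==> (col x == col (sg x)))).
  by apply: eq_forallb_in => x; rewrite inE => /andP[_ /eqP ->].
by move=> x o; rewrite col_sg2 // eq_sym froot_step.
Qed.

Definition smoothed alpha col m : bool :=
  if froot al m \in alpha then crossed_match col m else parallel_match col m.

Lemma smoothed_al alpha col m : smoothed alpha col (al m) = smoothed alpha col m.
Proof. by rewrite /smoothed froot_step // parallel_match_al crossed_match_al. Qed.

Lemma smoothing_const_froot alpha col :
  smoothing_const alpha col = [forall m, mt m ==> smoothed alpha col m].
Proof.
rewrite -forall_matching_edges => [|m _]; last exact: smoothed_al.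
by apply: eq_forallb_in => m; rewrite inE /smoothed => /andP[_ /eqP ->].
Qed.

Lemma edge_const_state_rel0P alpha beta col :
  reflect [/\ strand_const col,
              forall x, order sg x = 4 -> froot sg x \in beta -> col x = col (sg x)
            & forall m, mt m -> smoothed alpha col m]
          (edge_const (state_rel0 al sg mt alpha beta) col).
Proof.
apply: (iffP (edge_constP _ _)) => [same|[/strand_constP[col_al col_sg2] nodes smooth] x y].
  split=> [|x o xb|m mm].
  - apply/strand_constP; split=> [x mx|x o]; apply/esym/same; rewrite /state_rel0.
      by rewrite mt_al mx eqxx.
    by rewrite !mt_crossing ?order_sg // !eqxx o !orbT.
  - by apply: same; rewrite /state_rel0 !mt_crossing ?order_sg // !eqxx o xb !orbT.
  have [mt_sgm mt_sg2m] := mt_sg mm.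
  have [mt_sgam mt_sg2am] := mt_sg (etrans (mt_al m) mm).
  rewrite /smoothed; case: ifP => m_alpha; apply/andP; split; apply/eqP/same;
    rewrite /state_rel0 ?mt_sgm ?mt_sg2m ?mt_sgam ?mt_sg2am /=;
    by apply/or4P/Or44/existsP; exists m; rewrite /smooth_rel mm m_alpha !eqxx ?orbT.
case/andP=> /andP[mx _] /or4P[/eqP ->|/andP[/eqP o /eqP ->]||/existsP[m]].
- by rewrite col_al.
- by rewrite col_sg2.
- by case/andP=> /andP[/eqP o xb] /eqP ->; apply: nodes.
case/andP=> /smooth; rewrite /smoothed.
by case: ifP => _ /andP[/eqP first_arc /eqP second_arc] /orP[]/andP[/eqP -> /eqP ->].
Qed.

Lemma edge_const_state_rel alpha beta col :
  edge_const (state_rel al sg mt alpha beta) col =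
  [&& strand_const col, node_const beta col & smoothing_const alpha col].
Proof.
rewrite (edge_const_symmetrize (state_rel0 al sg mt alpha beta)).
rewrite smoothing_const_froot; apply/edge_const_state_rel0P/and3P.
  case=> sc nodes /forall_inP smooth; rewrite node_const_froot //.
  split=> //; apply/forall_inP=> x /eqP o; apply/implyP=> xb.
  by rewrite (nodes x o xb).
case=> sc; rewrite node_const_froot // => /forall_inP nodes /forall_inP smooth.
by split=> // x o xb; apply/eqP/(implyP (nodes x _) xb)/eqP.
Qed.

End States.

Section Brackets.
Variable n : nat.
Implicit Types (alpha beta : {set D}) (col : {ffun D -> 'I_n}).
Local Open Scope ring_scope.

(* Fixes the values on the matching darts, which lie on no curve. *)
Definition matching_copy col : bool := [forall m, mt m ==> (col m == col (sg m))].

Lemma expn_ncomp_state alpha beta :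
  (n ^ ncomp_state al sg mt alpha beta)%N
  = #|[set col : {ffun D -> 'I_n} |
          edge_const (state_rel al sg mt alpha beta) col && matching_copy col]|.
Proof.
set e := state_rel al sg mt alpha beta; pose k x := if mt x then sg x else x.
have e_mtF x y : e x y -> mt x = false /\ mt y = false.
  by case/orP=> /andP[/andP[/negPf + /negPf]].
have symE : connect_sym e by apply: sym_connect_sym => x y; rewrite /e /state_rel orbC.
rewrite -[n in LHS]card_ord -(@card_edge_const_retract _ _ e _ k symE); first last.
- by move=> x y exy; have [mx my] := e_mtF _ _ exy; rewrite /k mx my connect1.
- by move=> x; rewrite inE /k => /negPf ->.
- by move=> x; rewrite /k inE; case: ifPn => // /mt_sg[->].
- by move=> x y /e_mtF[mx my]; rewrite !inE mx my.
apply: eq_card => col; rewrite !inE; congr (_ && _).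
by apply: eq_forallb => m; rewrite /k; case: (mt m); rewrite ?eqxx.
Qed.

Lemma expn_ncomp_state_sum alpha beta :
  n%:Z ^+ ncomp_state al sg mt alpha beta =
  \sum_col (matching_copy col && strand_const col)%:R
    * ((smoothing_const alpha col)%:R * (node_const beta col)%:R).
Proof.
rewrite -[Posz n]natz -natrX expn_ncomp_state natr_card_set; apply: eq_bigr => col _.
rewrite edge_const_state_rel -!natrM !mulnb; case: matching_copy; case: strand_const => //=.
  by rewrite andbT andbC.
by rewrite andbF.
Qed.

Lemma sum_smoothing_const col (x : int) :
  \sum_(alpha in powerset (matching_edges al mt))
      x ^+ #|alpha| * (smoothing_const alpha col)%:R
  = \prod_(m in matching_edges al mt)
      (x * (crossed_match col m)%:R + (parallel_match col m)%:R).
Proof.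
under [RHS]eq_bigr do rewrite -[X in _ + X]mul1r.
rewrite -sum_powerset_forall; apply: eq_bigr => alpha _.
by rewrite expr1n mulr1.
Qed.

Lemma sum_node_const col :
  \sum_(beta in powerset (crossings sg))
      2%:Z ^+ #|beta| * (-1) ^+ (#|crossings sg| - #|beta|) * (node_const beta col)%:R
  = \prod_(x in crossings sg) (-1) ^+ (col x != col (sg x)).
Proof.
rewrite (sum_powerset_forall _ _ _ (fun x => col x == col (sg x)) xpredT).
by apply: eq_bigr => x _; case: eqP.
Qed.

Lemma signed_matching_weight col m :
  -1 * (crossed_match col m)%:R + (parallel_match col m)%:R
    = (-1) ^+ crossed_match col m * (two_colored col m)%:R :> int.
Proof. by rewrite parallel_matchE; case: crossed_match; case: two_colored. Qed.

Lemma signed_state_sum col : strand_const col ->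
  (\sum_(alpha in powerset (matching_edges al mt))
      (-1) ^+ #|alpha| * (smoothing_const alpha col)%:R)
    * (\sum_(beta in powerset (crossings sg))
        2%:Z ^+ #|beta| * (-1) ^+ (#|crossings sg| - #|beta|) * (node_const beta col)%:R)
  = (pm_coloring col)%:R.
Proof.
move=> sc; pose sgn (b : bool) : int := (-1) ^+ b.
have sgnM : {morph sgn : a b / a (+) b >-> a * b} by move=> a b; apply: signr_addb.
rewrite sum_smoothing_const sum_node_const -/sgn.
under eq_bigr do rewrite signed_matching_weight -/(sgn _).
rewrite big_split -natr_forall_in /= -!(big_morph sgn sgnM (erefl _ : sgn false = 1)).
rewrite mulrAC -sgnM /pm_coloring sc /=.
case: (boolP [forall m in _, _]) => [two|_]; last by rewrite mulr0.
by rewrite bichromatic_crossings_even // /pm_coloring sc.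
Qed.

Lemma pk_bracket_pm_colorings :
  pk_bracket al sg mt n
  = #|[set col : {ffun D -> 'I_n} | matching_copy col && pm_coloring col]|%:R.
Proof.
rewrite natr_card_set.
transitivity (\sum_col (matching_copy col && strand_const col)%:R *
  ((\sum_(alpha in powerset (matching_edges al mt))
       (-1) ^+ #|alpha| * (smoothing_const alpha col)%:R)
   * (\sum_(beta in powerset (crossings sg))
       2%:Z ^+ #|beta| * (-1) ^+ (#|crossings sg| - #|beta|) * (node_const beta col)%:R))).
  under [RHS]eq_bigr do rewrite big_distrlr mulr_sumr.
  rewrite exchange_big; apply: eq_bigr => alpha _ /=.
  under [RHS]eq_bigr do rewrite mulr_sumr.
  rewrite exchange_big; apply: eq_bigr => beta _ /=.
  by rewrite expn_ncomp_state_sum mulr_sumr; apply: eq_bigr => col _; ring.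
apply: eq_bigr => col _; have [sc|/negPf not_sc] := boolP (strand_const col).
  by rewrite signed_state_sum // -natrM mulnb andbT.
by rewrite /pm_coloring not_sc !andbF mul0r.
Qed.

Definition bichromatic_ends col : bool := [forall m, mt m ==> bichromatic_end col m].

Lemma bichromatic_ends_pm_coloring col : pm_coloring col -> bichromatic_ends col.
Proof.
case/andP=> _; rewrite forall_matching_edges => [/forall_inP two|m _].
  by apply/forall_inP=> m /two /andP[].
exact: two_colored_al.
Qed.

Lemma matching_copy_bichromatic_ends col :
  [forall m, mt m ==> (col m == col (sg m)) && (col (sg m) != col (sg (sg m)))]
  = matching_copy col && bichromatic_ends col.
Proof.
apply/forall_inP/andP => [both|[/forall_inP copy /forall_inP bi] m mm].
  by split; apply/forall_inP=> m /both /andP[].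
by apply/andP; split; [apply: copy | apply: bi].
Qed.

Lemma state_colorings_sum alpha :
  (state_colorings al sg mt n alpha)%:Z =
  \sum_col [&& matching_copy col, strand_const col & bichromatic_ends col]%:R
    * (smoothing_const alpha col)%:R.
Proof.
rewrite -[LHS]natz natr_card_set; apply: eq_bigr => col _.
rewrite matching_copy_bichromatic_ends -/(edge_const _ col) edge_const_state_rel.
rewrite (_ : node_const set0 col); last by apply/forall_inP=> x _; rewrite inE.
rewrite -natrM mulnb.
by case: matching_copy; case: strand_const; case: bichromatic_ends; case: smoothing_const.
Qed.

Lemma unsigned_state_sum col : strand_const col -> bichromatic_ends col ->
  \sum_(alpha in powerset (matching_edges al mt)) (smoothing_const alpha col)%:R
  = (pm_coloring col)%:R :> int.
Proof.
move=> sc /forall_inP bi.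
rewrite (eq_bigr (fun alpha => 1 ^+ #|alpha| * (smoothing_const alpha col)%:R)); last first.
  by move=> alpha _; rewrite expr1n mul1r.
rewrite sum_smoothing_const /pm_coloring sc natr_forall_in.
apply: eq_bigr => m; rewrite inE => /andP[/bi bi_m _].
have := parallel_matchE col m; rewrite /two_colored bi_m.
by case: parallel_match; case: crossed_match.
Qed.

Lemma color_bracket_pm_colorings :
  color_bracket al sg mt n
  = #|[set col : {ffun D -> 'I_n} | matching_copy col && pm_coloring col]|%:R.
Proof.
rewrite natr_card_set /color_bracket; under eq_bigr do rewrite state_colorings_sum.
rewrite exchange_big; apply: eq_bigr => col _; rewrite -mulr_sumr.
have [sc|/negPf not_sc] := boolP (strand_const col); last first.
  by rewrite /pm_coloring not_sc !andbF mul0r.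
have [bi|not_bi] := boolP (bichromatic_ends col).
  by rewrite unsigned_state_sum // -natrM mulnb !andbT.
by rewrite (contraNF (@bichromatic_ends_pm_coloring col) not_bi) !andbF mul0r.
Qed.

End Brackets.
End Diagram.

Theorem theorem4p10 (D : finType) (al sg : D -> D) (mt : D -> bool) (n : nat) :
  trivalent_pm_diagram al sg mt -> (0 < n)%N ->
  pk_bracket al sg mt n = color_bracket al sg mt n.
Proof.
by move=> diag _; rewrite pk_bracket_pm_colorings // color_bracket_pm_colorings.
Qed.
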